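(* Let $ABC$ be a nondegenerate triangle with orthocenter $H$. For every admissible pair of cevians $BB_A, CC_A$ with Miquel–Steiner point $M_A$, one has $M_A=H$ if and only if $|BB_A|=|CC_A|=|BC|$.
   Context: Work in the Euclidean plane with a nondegenerate triangle $ABC$. An admissible pair of cevians consists of lines $BB_A$ and $CC_A$, where $B_A$ is a point of line $AC$ with $B_A\neq A, C$, and $C_A$ is a point of line $AB$ with $C_A\neq A, B$ (the points may lie outside the sides), such that $BB_A$ and $CC_A$ are not parallel. Let $N_A$ be the intersection point of $BB_A$ and $CC_A$. The circumcircles of the four triangles $ABB_A$, $ACC_A$, $CB_AN_A$, $BC_AN_A$ have a unique common point $M_A$, called the Miquel–Steiner point of triangle $ABC$ with cevians $BB_A, CC_A$ (equivalently, $M_A$ is the common point other than $A$ of the circumcircles of $ABB_A$ and $ACC_A$). *)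

(* Defs.v *)
From Stdlib Require Import Reals.
Open Scope R_scope.

Definition point : Type := (R * R)%type.

Definition vec (P Q : point) : point := (fst Q - fst P, snd Q - snd P).

Definition dot (u v : point) : R := fst u * fst v + snd u * snd v.

Definition cross (u v : point) : R := fst u * snd v - snd u * fst v.

Definition edist (P Q : point) : R := dist_euc (fst P) (snd P) (fst Q) (snd Q).

(* [X] lies on the line through [P] and [Q]; meaningful for [P <> Q]. *)
Definition on_line (P Q X : point) : Prop := cross (vec P Q) (vec P X) = 0.

(* The lines [PQ] and [RS] are parallel or equal; meaningful for
   [P <> Q] and [R <> S]. *)
Definition parallel (P Q R S : point) : Prop := cross (vec P Q) (vec R S) = 0.

Definition nondegenerate (A B C : point) : Prop := ~ on_line A B C.

Definition is_orthocenter (A B C H : point) : Prop :=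
  dot (vec A H) (vec B C) = 0 /\
  dot (vec B H) (vec C A) = 0 /\
  dot (vec C H) (vec A B) = 0.

Definition is_circumcenter (P Q R O : point) : Prop :=
  edist O P = edist O Q /\ edist O Q = edist O R.

(* [X] lies on the circle through [P], [Q], [R]; the center is unique when
   [PQR] is a nondegenerate triangle. *)
Definition on_circumcircle (P Q R X : point) : Prop :=
  exists O : point, is_circumcenter P Q R O /\ edist O X = edist O P.

(* The two lines [B BA] and [C CA] cannot coincide under the other conditions,
   so the last one says exactly that they meet in a single point. *)
Definition admissible_cevians (A B C BA CA : point) : Prop :=
  (on_line A C BA /\ BA <> A /\ BA <> C) /\
  (on_line A B CA /\ CA <> A /\ CA <> B) /\
  ~ parallel B BA C CA.

Definition is_intersection (P Q R S X : point) : Prop :=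
  on_line P Q X /\ on_line R S X.

(* [NA] is meant to be the intersection of the lines [B BA] and [C CA].
   For a nondegenerate triangle with admissible cevians the four triangles
   below are nondegenerate and exactly one point satisfies this predicate. *)
Definition is_Miquel_Steiner (A B C BA CA NA M : point) : Prop :=
  on_circumcircle A B BA M /\
  on_circumcircle A C CA M /\
  on_circumcircle C BA NA M /\
  on_circumcircle B CA NA M.

(* Main.v *)
(** Put the origin at [A] and write [b], [c], [h], [m] for [B], [C], [H], [MA],
    with [BA = t c] and [CA = s b].  A circle through the origin is
    [x.x = u.x], where [u] is the antipode of the origin; let [u] and [v] belong
    to the circles [A B BA] and [A C CA].  Then [u.b = b.b], [u.c = t c.c],
    [v.b = s b.b], [v.c = c.c], while [h.b = h.c = b.c].  The length conditions
    amount to [(t + 1) c.c = 2 b.c] and [(s + 1) b.b = 2 b.c], that is, to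
    [u = h + (b - c)] and [v = h - (b - c)].  As [h] is orthogonal to [b - c],
    these equalities put [h] on both circles; conversely [u - h] and [b - c]
    are parallel if [h] is on the first circle, and comparing their products
    with [b] gives [u - h = b - c], unless [h = b], which would put [B] on the
    circle [A C CA].  The circle [C BA NA] is needed only to
    exclude [MA = A]. *)
Require Import Defs.
From Stdlib Require Import Reals Lra.
Open Scope R_scope.

(** * Vector algebra in the plane *)

Definition vsub (v w : point) : point := (fst v - fst w, snd v - snd w).

Definition vscale (k : R) (v : point) : point := (k * fst v, k * snd v).

Lemma dot_sym (v w : point) : dot v w = dot w v.
Proof. unfold dot; ring. Qed.

Lemma dot_vsub_l (v w x : point) : dot (vsub v w) x = dot v x - dot w x.
Proof. unfold dot, vsub; simpl; ring. Qed.

Lemma dot_vsub_r (x v w : point) : dot x (vsub v w) = dot x v - dot x w.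
Proof. unfold dot, vsub; simpl; ring. Qed.

Lemma dot_vscale_r (x v : point) (k : R) : dot x (vscale k v) = k * dot x v.
Proof. unfold dot, vscale; simpl; ring. Qed.

Lemma dot_vscale_l (v x : point) (k : R) : dot (vscale k v) x = k * dot v x.
Proof. unfold dot, vscale; simpl; ring. Qed.

Lemma dot_self_pos (v : point) : v <> (0, 0) -> 0 < dot v v.
Proof.
  destruct v as [x y]; unfold dot; simpl; intros Hv.
  destruct (Req_dec x 0) as [-> | Hx]; [| nra].
  destruct (Req_dec y 0) as [-> | Hy]; [now destruct Hv | nra].
Qed.

Lemma cross_neq0_l (v w : point) : cross v w <> 0 -> v <> (0, 0).
Proof. intros H ->; apply H; unfold cross; simpl; ring. Qed.

Lemma cross_neq0_r (v w : point) : cross v w <> 0 -> w <> (0, 0).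
Proof. intros H ->; apply H; unfold cross; simpl; ring. Qed.

Lemma cross_eq0_scale (v w : point) :
  v <> (0, 0) -> cross v w = 0 -> exists k, w = vscale k v.
Proof.
  intros Hv H; pose proof (dot_self_pos v Hv) as Hp.
  (* Pairing [w = k v] with [v] leaves only this value of [k]. *)
  exists (dot v w / dot v v).
  destruct v as [v1 v2], w as [w1 w2]; unfold dot, cross, vscale in *; simpl in *.
  assert (E : v1 * w2 = v2 * w1) by lra.
  f_equal; apply Rmult_eq_reg_r with (v1 * v1 + v2 * v2); try lra.
  - transitivity ((v1 * w1 + v2 * w2) * v1); [| field; lra].
    replace ((v1 * w1 + v2 * w2) * v1) with (v1 * v1 * w1 + v2 * (v1 * w2)) by ring.
    rewrite E; ring.
  - transitivity ((v1 * w1 + v2 * w2) * v2); [| field; lra].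
    replace ((v1 * w1 + v2 * w2) * v2) with (v1 * (v2 * w1) + v2 * v2 * w2) by ring.
    rewrite <- E; ring.
Qed.

(** In the plane, the vectors orthogonal to a nonzero [h] form a line. *)
Lemma orthogonal_cross (h v w : point) :
  h <> (0, 0) -> dot v h = 0 -> dot w h = 0 -> cross v w = 0.
Proof.
  intros Hh Hv Hw; pose proof (dot_self_pos h Hh) as Hp.
  apply Rmult_eq_reg_r with (dot h h); [| lra].
  replace (cross v w * dot h h) with (cross h w * dot v h - cross h v * dot w h)
    by (unfold cross, dot; ring).
  rewrite Hv, Hw; ring.
Qed.

(** Cramer's rule with determinant [cross b c]. *)
Lemma dot_basis_inj (b c v w : point) :
  cross b c <> 0 -> dot v b = dot w b -> dot v c = dot w c -> v = w.
Proof.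
  destruct b as [b1 b2], c as [c1 c2], v as [v1 v2], w as [w1 w2].
  unfold cross, dot; simpl; intros H Hb Hc.
  f_equal; apply Rmult_eq_reg_r with (b1 * c2 - b2 * c1); trivial.
  - transitivity (c2 * (v1 * b1 + v2 * b2) - b2 * (v1 * c1 + v2 * c2)); [ring |].
    rewrite Hb, Hc; ring.
  - transitivity (b1 * (v1 * c1 + v2 * c2) - c1 * (v1 * b1 + v2 * b2)); [ring |].
    rewrite Hb, Hc; ring.
Qed.

(** Two circles through the origin have antipodes [u] and [v]. Their common points are orthogonal to
    [u - v], so [m = k h], and the first circle gives [k * k = k]. *)
Lemma circles_second_intersection (u v m h : point) :
  u <> v -> m <> (0, 0) -> h <> (0, 0) ->
  dot u m = dot m m -> dot v m = dot m m ->
  dot u h = dot h h -> dot v h = dot h h -> m = h.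
Proof.
  intros Huv Hm Hh Hum Hvm Huh Hvh.
  assert (Hw : vsub u v <> (0, 0)).
  { intros E; apply Huv; destruct u, v; unfold vsub in E; simpl in E.
    injection E as E1 E2; f_equal; lra. }
  assert (Hx : cross h m = 0).
  { apply (orthogonal_cross (vsub u v)); trivial; rewrite dot_vsub_r;
      [rewrite (dot_sym h u), (dot_sym h v) | rewrite (dot_sym m u), (dot_sym m v)]; lra. }
  destruct (cross_eq0_scale h m Hh Hx) as [k ->].
  rewrite dot_vscale_r, dot_vscale_r, dot_vscale_l, Huh in Hum.
  pose proof (dot_self_pos h Hh) as Hp.
  assert (Hk : k * (k - 1) = 0) by nra.
  destruct (Rmult_integral _ _ Hk) as [-> | E].
  - destruct Hm; unfold vscale; f_equal; ring.
  - replace k with 1 by lra; destruct h; unfold vscale; simpl; f_equal; ring.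
Qed.

(** * Distances, circles through [A] and points of its sides *)

Lemma edist_eq_iff (P Q S T : point) :
  edist P Q = edist S T <-> dot (vec P Q) (vec P Q) = dot (vec S T) (vec S T).
Proof.
  assert (E : forall X Y, edist X Y = sqrt (dot (vec X Y) (vec X Y))).
  { intros [x1 x2] [y1 y2]; unfold edist, dist_euc, dot, vec, Rsqr; simpl; f_equal; ring. }
  assert (Hpos : forall v, 0 <= dot v v) by (intros [x y]; unfold dot; simpl; nra).
  rewrite !E; split; [apply sqrt_inj; apply Hpos | congruence].
Qed.

Lemma vec_vsub (A P Q : point) : vec P Q = vsub (vec A Q) (vec A P).
Proof. unfold vec, vsub; simpl; f_equal; ring. Qed.

Lemma vec_neq0 (A P : point) : P <> A -> vec A P <> (0, 0).
Proof.
  intros H E; apply H; destruct A, P; unfold vec in E; simpl in E.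
  injection E as E1 E2; f_equal; lra.
Qed.

Lemma vec_inj (A P Q : point) : vec A P = vec A Q -> P = Q.
Proof.
  destruct A, P, Q; unfold vec; simpl; intros E; injection E as E1 E2; f_equal; lra.
Qed.

(** Thales' theorem: [vscale 2 (vec A O)] is the diameter from [A], and it is seen from [P] at a
    right angle. *)
Lemma circle_antipode (A P O : point) :
  edist O P = edist O A ->
  dot (vscale 2 (vec A O)) (vec A P) = dot (vec A P) (vec A P).
Proof.
  rewrite edist_eq_iff; destruct A, P, O; unfold dot, vec, vscale; simpl; lra.
Qed.

Lemma on_circumcircle_antipode (A P Q X : point) :
  on_circumcircle A P Q X ->
  exists u, dot u (vec A P) = dot (vec A P) (vec A P) /\
            dot u (vec A Q) = dot (vec A Q) (vec A Q) /\
            dot u (vec A X) = dot (vec A X) (vec A X).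
Proof.
  intros (O & (H1 & H2) & H3); exists (vscale 2 (vec A O)).
  repeat split; apply circle_antipode; congruence.
Qed.

Lemma point_on_secant (A C X : point) :
  C <> A -> on_line A C X -> X <> A -> X <> C ->
  exists t, vec A X = vscale t (vec A C) /\ t <> 0 /\ t <> 1.
Proof.
  intros HC Hl HA HX.
  destruct (cross_eq0_scale _ _ (vec_neq0 A C HC) Hl) as [t Ht].
  exists t; repeat split; trivial; intros ->.
  - apply (vec_neq0 A X HA); rewrite Ht; unfold vscale; f_equal; ring.
  - apply HX, (vec_inj A); rewrite Ht; destruct (vec A C); unfold vscale; simpl; f_equal; ring.
Qed.

(** A line meets a circle in at most two points, whereas [A], [C], [X] are distinct and
    collinear. *)
Lemma not_on_secant_circle (A C X N : point) :
  C <> A -> on_line A C X -> X <> A -> X <> C -> ~ on_circumcircle C X N A.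
Proof.
  intros HC Hl HA HX (O & (H1 & H2) & H3).
  destruct (point_on_secant A C X HC Hl HA HX) as (t & Ht & Ht0 & Ht1).
  pose proof (circle_antipode A C O (eq_sym H3)) as E1.
  assert (E2 : edist O X = edist O A) by congruence.
  apply circle_antipode in E2; rewrite Ht, dot_vscale_r, E1, dot_vscale_r, dot_vscale_l in E2.
  pose proof (dot_self_pos _ (vec_neq0 A C HC)) as Hp.
  assert (E3 : t * (t - 1) = 0) by nra.
  destruct (Rmult_integral _ _ E3); lra.
Qed.

(** * Cevian lengths and the orthocenter *)

Lemma antipode_dot_secant (u c : point) (t : R) :
  t <> 0 -> dot u (vscale t c) = dot (vscale t c) (vscale t c) ->
  dot u c = t * dot c c.
Proof.
  rewrite !dot_vscale_r, dot_vscale_l; intros Ht H.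
  now apply Rmult_eq_reg_l in H.
Qed.

(** The two squared lengths differ by [(t - 1) * ((t + 1) * dot c c - 2 * dot b c)]; the root
    [t = 1] is the cevian [BC] itself. *)
Lemma cevian_length_iff (b c : point) (t : R) :
  t <> 1 ->
  dot (vsub (vscale t c) b) (vsub (vscale t c) b) = dot (vsub c b) (vsub c b) <->
  (t + 1) * dot c c = 2 * dot b c.
Proof.
  intros Ht.
  rewrite !dot_vsub_l, !dot_vsub_r, !dot_vscale_r, !dot_vscale_l, (dot_sym c b).
  split; intros H; [apply Rmult_eq_reg_l with (t - 1) |]; nra.
Qed.

Lemma orthocenter_on_circle (b c h u : point) (t : R) :
  cross b c <> 0 -> dot h b = dot b c -> dot h c = dot b c ->
  h <> (0, 0) -> h <> b ->
  dot u b = dot b b -> dot u c = t * dot c c -> dot u h = dot h h ->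
  (t + 1) * dot c c = 2 * dot b c.
Proof.
  intros Hbc Hhb Hhc Hh0 Hhb' Hub Huc Huh.
  assert (Hx : cross (vsub u h) (vsub c b) = 0).
  { apply (orthogonal_cross h); trivial; rewrite dot_vsub_l; [lra |].
    rewrite (dot_sym c h), (dot_sym b h); lra. }
  (* Otherwise [h] and [b] have the same products with [b] and [c]. *)
  assert (Hne : dot b c - dot b b <> 0).
  { intros E; apply Hhb', (dot_basis_inj b c); trivial; lra. }
  set (e := vsub u h) in *; set (f := vsub c b) in *.
  assert (He : dot e b = dot b b - dot b c) by (unfold e; rewrite dot_vsub_l; lra).
  assert (Hf : dot f b = dot b c - dot b b)
    by (unfold f; rewrite dot_vsub_l, (dot_sym c b); lra).
  (* The Binet-Cauchy identity: as [e] and [f] are parallel, their products with [b] and [c] are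
     proportional. *)
  assert (I : dot f b * dot e c - dot e b * dot f c = cross e f * cross c b)
    by (unfold dot, cross; ring).
  rewrite Hx, He, Hf in I.
  assert (Hec : dot e c = t * dot c c - dot b c) by (unfold e; rewrite dot_vsub_l; lra).
  assert (Hfc : dot f c = dot c c - dot b c) by (unfold f; rewrite dot_vsub_l; lra).
  rewrite Hec, Hfc in I.
  apply Rmult_eq_reg_l with (dot b c - dot b b); trivial; lra.
Qed.

Lemma antipode_of_cevian_length (b c h u : point) (t : R) :
  cross b c <> 0 -> dot h b = dot b c -> dot h c = dot b c ->
  dot u b = dot b b -> dot u c = t * dot c c ->
  (t + 1) * dot c c = 2 * dot b c ->
  u = vsub h (vsub c b).
Proof.
  intros Hbc Hhb Hhc Hub Huc Ht; apply (dot_basis_inj b c); trivial;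
    rewrite !dot_vsub_l, ?(dot_sym c b); lra.
Qed.

Theorem mainTheorem6 (A B C H : point)
    (hABC : nondegenerate A B C)
    (hH : is_orthocenter A B C H)
    (BA CA NA MA : point)
    (hcev : admissible_cevians A B C BA CA)
    (hNA : is_intersection B BA C CA NA)
    (hMA : is_Miquel_Steiner A B C BA CA NA MA) :
  MA = H <-> (edist B BA = edist C CA /\ edist C CA = edist B C).
Proof.
  destruct hcev as ((HlB & HBA & HBC) & (HlC & HCA & HCB) & Hpar).
  destruct hMA as (K1 & K2 & K3 & _).
  unfold nondegenerate, on_line in hABC.
  assert (HC : C <> A).
  { intros ->; apply hABC; unfold cross, vec; simpl; ring. }
  assert (HB : B <> A).
  { intros ->; apply hABC; unfold cross, vec; simpl; ring. }
  assert (HM : vec A MA <> (0, 0)).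
  { apply vec_neq0; intros ->.
    exact (not_on_secant_circle A C BA NA HC HlB HBA HBC K3). }
  destruct (point_on_secant A C BA HC HlB HBA HBC) as (t & Ht & Ht0 & Ht1).
  destruct (point_on_secant A B CA HB HlC HCA HCB) as (s & Hs & Hs0 & Hs1).
  destruct (on_circumcircle_antipode _ _ _ _ K1) as (u & Hub & Huc & Hum).
  destruct (on_circumcircle_antipode _ _ _ _ K2) as (v & Hvc & Hvb & Hvm).
  rewrite Ht in Huc; rewrite Hs in Hvb.
  apply antipode_dot_secant in Huc; [| exact Ht0].
  apply antipode_dot_secant in Hvb; [| exact Hs0].
  destruct hH as (E1 & E2 & E3).
  unfold parallel in Hpar.
  rewrite (vec_vsub A B BA), (vec_vsub A C CA), Ht, Hs in Hpar.
  rewrite (vec_vsub A B C) in E1.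
  rewrite (vec_vsub A B H) in E2.
  rewrite (vec_vsub A C H) in E3.
  assert (HCAvec : vec C A = vsub (0, 0) (vec A C))
    by (unfold vec, vsub; simpl; f_equal; ring).
  rewrite HCAvec in E2.
  rewrite !edist_eq_iff.
  rewrite (vec_vsub A B BA), (vec_vsub A C CA), (vec_vsub A B C), Ht, Hs.
  assert (Hinj : MA = H <-> vec A MA = vec A H)
    by (split; [now intros -> | apply vec_inj]).
  rewrite Hinj; clear Hinj HCAvec.
  set (b := vec A B) in *; set (c := vec A C) in *.
  set (h := vec A H) in *; set (m := vec A MA) in *.
  assert (Hhb : dot h b = dot b c).
  { rewrite dot_vsub_l, (dot_sym c b) in E3; lra. }
  assert (Hhc : dot h c = dot b c).
  { rewrite dot_vsub_r in E1; lra. }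
  clearbody b c h m.
  assert (hcb : cross c b <> 0) by (unfold cross in *; lra).
  pose proof (dot_self_pos b (cross_neq0_l _ _ hABC)) as Hp.
  pose proof (dot_self_pos c (cross_neq0_r _ _ hABC)) as Hq.
  pose proof (cevian_length_iff b c t Ht1) as LB.
  pose proof (cevian_length_iff c b s Hs1) as LC.
  rewrite (dot_sym c b) in LC.
  assert (Sym : dot (vsub b c) (vsub b c) = dot (vsub c b) (vsub c b))
    by (unfold dot, vsub; simpl; ring).
  rewrite Sym in LC.
  split.
  - intros ->.
    assert (T : (t + 1) * dot c c = 2 * dot b c).
    { apply (orthocenter_on_circle b c h u t); trivial.
      (* If [h = b], then [B] is on the circle [A C CA], so [dot v b] equals both [dot b b] and
         [s * dot b b]. *)
      intros ->; rewrite Hvm in Hvb; apply Hs1.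
      apply Rmult_eq_reg_r with (dot b b); lra. }
    assert (S : (s + 1) * dot b b = 2 * dot b c).
    { rewrite (dot_sym b c).
      (* The second circle is the first with [b] and [c] exchanged; here the excluded case is
         [h = c]. *)
      apply (orthocenter_on_circle c b h v s); trivial; try (rewrite (dot_sym c b); assumption).
      intros ->; rewrite Hum in Huc; apply Ht1.
      apply Rmult_eq_reg_r with (dot c c); lra. }
    apply LB in T; apply LC in S; split; congruence.
  - intros (F1 & F2).
    assert (T : (t + 1) * dot c c = 2 * dot b c) by (apply LB; congruence).
    assert (S : (s + 1) * dot b b = 2 * dot b c) by (apply LC; exact F2).
    pose proof (antipode_of_cevian_length b c h u t hABC Hhb Hhc Hub Huc T) as Hu.
    assert (Hv : v = vsub h (vsub b c)).
    { apply (antipode_of_cevian_length c b h v s); trivial; rewrite (dot_sym c b); trivial. }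
    apply (circles_second_intersection u v); trivial.
    (* If the circles coincided, comparing their products with [b] would give [s = 1]. *)
    + intros ->; apply Hs1; apply Rmult_eq_reg_r with (dot b b); lra.
    + (* With a right angle at [A], [t = s = -1] and the cevians are parallel. *)
      intros ->; apply Hpar.
      assert (Z : dot b c = 0) by (rewrite <- Hhb; unfold dot; simpl; ring).
      rewrite Z in T, S.
      assert (Et : t = -1) by (apply Rmult_eq_reg_r with (dot c c); lra).
      assert (Es : s = -1) by (apply Rmult_eq_reg_r with (dot b b); lra).
      rewrite Et, Es; unfold cross, vsub, vscale; simpl; ring.
    (* The term [c - b] contributes nothing, being orthogonal to [h]. *)
    + rewrite Hu, !dot_vsub_l, (dot_sym c h), (dot_sym b h); lra.
    + rewrite Hv, !dot_vsub_l, (dot_sym c h), (dot_sym b h); lra.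
Qed.
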